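(* Let $h$ and $k$ be positive integers such that $3 \leq h \leq k-1$ and $k \geq 5$. Let $A=\{a_1,a_2,\ldots,a_k\}$ be a set of nonnegative integers such that $0=a_1<a_2<\cdots<a_k$. If \[ |h^{\wedge}_{\pm}A| = 2hk - h(h+1) + 1, \] then $A = a_2 \ast [0,4]$ or $A = a_2 \ast \{0,1,2,4,6\}$ if $h=4$ and $k=5$, and $A = a_2 \ast [0,k-1]$ otherwise.
   Context: For a finite set $A=\{a_1,\ldots,a_k\}$ of integers and a positive integer $h$, the restricted $h$-fold signed sumset is $h^{\wedge}_{\pm}A=\left\{\sum_{i=1}^{k}\lambda_i a_i : \lambda_i\in\{-1,0,1\} \text{ for all } i,\ \sum_{i=1}^{k}|\lambda_i| = h\right\}$. For integers $a\le b$, $[a,b]=\{n\in\mathbb{Z}: a\le n\le b\}$. For an integer $c$ and a set $S$ of integers, $c\ast S=\{cs : s\in S\}$. *)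

(* Defs.v *)
From mathcomp Require Import all_boot all_order all_algebra finmap.

Set Implicit Arguments.
Unset Strict Implicit.
Unset Printing Implicit Defensive.

Import Order.TTheory GRing.Theory Num.Theory.
Local Open Scope fset_scope.
Local Open Scope ring_scope.

Notation coeffs A := {ffun A -> [fset (-1 : int); 0; 1]}.

(* The set $h^{\wedge}_{\pm} A$. *)
Definition signed_sumset (h : nat) (A : {fset int}) : {fset int} :=
  [fset \sum_(x : A) val (lam x) * val x
     | lam : coeffs A
       in [pred lam : coeffs A | \sum_(x : A) `|val (lam x)| == h%:Z]].

Lemma signed_sumsetP (h : nat) (A : {fset int}) (n : int) :
  reflect
    (exists lam : int -> int,
       [/\ forall x, x \in A -> lam x = -1 \/ lam x = 0 \/ lam x = 1,
           \sum_(x <- A) `|lam x| = h%:Z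
         & n = \sum_(x <- A) lam x * x])
    (n \in signed_sumset h A).
Proof.
apply: (iffP (imfsetP _ _ _ _)) => /= [[lam] | [lam [lamA lamh ->]]].
  move=> /eqP lamh ->.
  pose l (x : int) : int := if insub x is Some y then val (lam y) else 0.
  have lE (x : A) : l (val x) = val (lam x) by rewrite /l valK.
  exists l; split.
  - move=> x xA; rewrite -[x]/(val [` xA]) lE.
    have := valP (lam [` xA]); rewrite !inE -orbA.
    by case/or3P => /eqP ->; [left | right; left | right; right].
  - by rewrite big_seq_fsetE /= -lamh; apply: eq_bigr => x _; rewrite lE.
  - by rewrite big_seq_fsetE /=; apply: eq_bigr => x _; rewrite lE.
have lamP (x : A) : lam (val x) \in [fset (-1 : int); 0; 1].
  by case: (lamA _ (valP x)) => [|[]] ->; rewrite !inE eqxx ?orbT.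
exists [ffun x => [` lamP x]].
  apply/eqP; rewrite -lamh big_seq_fsetE /=.
  by apply: eq_bigr => x _; rewrite ffunE.
by rewrite big_seq_fsetE /=; apply: eq_bigr => x _; rewrite ffunE.
Qed.

Definition int_itv (a b : int) : {fset int} :=
  [fset n in [seq a + i%:Z | i <- iota 0 `|b - a|%N.+1] | a <= n <= b].

Lemma in_int_itv (a b n : int) : (n \in int_itv a b) = (a <= n <= b).
Proof.
rewrite in_fset; apply/andP/idP => [[] // | /[dup] anb /andP[an nb]].
split=> //; apply/mapP; exists `|n - a|%N; last first.
  by rewrite gez0_abs ?subr_ge0// subrKC.
rewrite mem_iota add0n ltnS /= -lez_nat !gez0_abs ?subr_ge0 ?lerD2r//.
exact: le_trans nb.
Qed.

Definition dilate (c : int) (S : {fset int}) : {fset int} :=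
  [fset c * s | s in S].

(* Main.v *)
Require Import Defs.
From mathcomp Require Import all_boot all_order all_algebra finmap.
From mathcomp Require Import zify ring.

Set Implicit Arguments.
Unset Strict Implicit.
Unset Printing Implicit Defensive.

Import Order.TTheory GRing.Theory Num.Theory.
Local Open Scope fset_scope.
Local Open Scope ring_scope.

(** Write A = {0} u B with |B| = m = k - 1; the sums of A with h nonzero signs
are the sums of B with h or h - 1 nonzero signs. Their number is bounded below
by removing the largest element x of B. If h < m, then 2h sums exceed in
absolute value all those that avoid x. If h = m, fix the sign of x to be +1:
this leaves the sums of B \ {x} for h = m - 1, and every sum of the form o - T
with o < 2x, where T is the sum of B, is below all of these; there are at
least 2m such sums. Hence extremality is inherited by B \ {x}, down to m = 4,
where comparing a few linear forms leaves only the multiples of (1, 2, 3, 4)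
and of (1, 2, 4, 6). Going up again, the sums of c * [1, n] fill an interval of
multiples of c, which determines x, while (1, 2, 4, 6) has no extremal
extension. *)

(** * Sums, coefficient vectors and counting *)

(* The sums of [s] with [h] or [h - 1] nonzero signs, i.e. the sums of
   [{0} u s] with [h] nonzero signs. *)
Fixpoint ssums (h : nat) (s : seq int) : seq int :=
  if s is b :: s' then
    ssums h s' ++
    (if h is h'.+1 then
       [seq b + x | x <- ssums h' s'] ++ [seq - b + x | x <- ssums h' s']
     else [::])
  else if (h <= 1)%N then [:: 0] else [::].

Fixpoint dot (v s : seq int) : int :=
  match v, s with l :: v', b :: s' => l * b + dot v' s' | _, _ => 0 end.

(** The sign of the element 0 is left free, hence the two admissible counts. The predicate is
    boolean, so explicit vectors are checked by computation. *)
Definition sign_vector (h : nat) (v : seq int) :=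
  all [in [:: -1; 0; 1 : int]] v
  && (count (predC1 (0 : int)) v <= h <= (count (predC1 (0 : int)) v).+1)%N.

Lemma ssums_consS h b s y :
  (y \in ssums h.+1 (b :: s)) =
  [|| y \in ssums h.+1 s, y - b \in ssums h s | y + b \in ssums h s].
Proof.
rewrite /= !mem_cat; congr [|| _, _ | _].
- apply/mapP/idP => [[x xs ->]|ys]; first by rewrite addrC addKr.
  by exists (y - b); rewrite // addrC subrK.
- apply/mapP/idP => [[x xs ->]|ys]; first by rewrite addrC addNKr.
  by exists (y + b); rewrite // addrC addrK.
Qed.

Lemma ssums0 s : ssums 0 s = [:: 0].
Proof. by elim: s => //= b s ->. Qed.

Lemma ssumsP h s y :
  reflect (exists v, [/\ size v = size s, sign_vector h v & y = dot v s])
          (y \in ssums h s).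
Proof.
apply: (iffP idP) => [|[v [+ + ->]]].
  elim: s h y => [|b s IHs] h y.
    case: h => [|[|h]]; rewrite //= inE => /eqP ->; by exists [::].
  case: h => [|h].
    rewrite ssums0 inE => /eqP ->; exists (nseq (size s).+1 0).
    rewrite size_nseq /sign_vector all_nseq count_nseq /= mul0n; split => //.
    by rewrite mul0r add0r; elim: (s) => //= c t <-; rewrite mul0r.
  rewrite ssums_consS => /or3P[] /IHs[v [szv /andP[v1 vc] yE]].
  - exists (0 :: v); rewrite /= szv mul0r add0r; split=> //; exact/andP.
  - exists (1 :: v); rewrite /= szv mul1r -yE addrC subrK.
    by split=> //; apply/andP; split.
  - exists (-1 :: v); rewrite /= szv mulN1r -yE addrC addrK.
    by split=> //; apply/andP; split.
elim: v s h => [|l v IHv] [|b s] h //=.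
  by rewrite /sign_vector /=; case: h => [|[|h]].
move=> [szv] /andP[/= /andP[l1 v1]]; case: h => [|h].
  have [-> /=|//] := eqVneq l 0.
  rewrite add0n mul0r add0r => vc; rewrite cats0; apply: IHv => //.
  exact/andP.
rewrite -[_ ++ _]/(ssums h.+1 (b :: s)) ssums_consS.
move: l1; rewrite !inE => /or3P[] /eqP -> vc.
- apply/or3P/Or33; rewrite mulN1r addrAC addNr add0r; apply: IHv => //.
  exact/andP.
- apply/or3P/Or31; rewrite mul0r add0r; apply: IHv => //.
  exact/andP.
- apply/or3P/Or32; rewrite mul1r addrAC subrr add0r; apply: IHv => //.
  exact/andP.
Qed.

Lemma dot_map (f : int -> int) s : dot (map f s) s = \sum_(x <- s) f x * x.
Proof. by elim: s => [|b s /= ->]; rewrite ?big_nil ?big_cons. Qed.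

Lemma mem_ssums_fun (f : int -> int) h s :
    {in s, forall x, f x \in [:: -1; 0; 1]} ->
    (count (fun x => f x != 0) s <= h <= (count (fun x => f x != 0) s).+1)%N ->
  \sum_(x <- s) f x * x \in ssums h s.
Proof.
move=> f1 fc; apply/ssumsP; exists (map f s); rewrite size_map dot_map.
split=> //; apply/andP; split; last by rewrite count_map.
by rewrite all_map; apply/allP => x /f1.
Qed.

Lemma ssums_opp h s y : (- y \in ssums h s) = (y \in ssums h s).
Proof.
suff imp z : z \in ssums h s -> - z \in ssums h s.
  by apply/idP/idP => [/imp|/imp //]; rewrite opprK.
elim: s h z => [|b s IHs] h z.
  by case: h => [|[|h]]; rewrite //= !inE oppr_eq0.
case: h => [|h]; first by rewrite ssums0 !inE oppr_eq0.
rewrite !ssums_consS; case/or3P => [/IHs -> //|/IHs|/IHs].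
  by rewrite opprB addrC => ->; rewrite !orbT.
by rewrite opprD => ->; rewrite orbT.
Qed.

Definition nssums h s := size (undup (ssums h s)).

Lemma size_le_nssums h s t :
  uniq t -> {subset t <= ssums h s} -> (size t <= nssums h s)%N.
Proof.
by move=> tU ts; apply: uniq_leq_size => // x /ts; rewrite mem_undup.
Qed.

(** A vector on [s] with one sign too few is completed by giving 0 the coefficient 1, which does not
    change the sum. *)
Lemma nssums_le_signed_sumset h (s : seq int) (A : {fset int}) :
    (0 < h)%N -> uniq s -> 0 \notin s -> A =i 0 :: s ->
  (nssums h s <= #|` signed_sumset h A|)%N.
Proof.
move=> h_gt0 sU s0 As; rewrite /nssums; apply: uniq_leq_size => [|y].
  exact: undup_uniq.
rewrite mem_undup => /ssumsP[v [szv /andP[/allP v1 vc] ->]].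
have AsP : perm_eq A (0 :: s).
  by apply: uniq_perm; rewrite ?fset_uniq //= s0.
pose l0 : int := (count (predC1 (0 : int)) v != h)%:Z.
pose l x := if x == 0 then l0 else nth 0 v (index x s).
have lE : [seq l x | x <- s] = v.
  apply: (@eq_from_nth _ 0); rewrite size_map // => i i_lt.
  rewrite (nth_map 0) // /l index_uniq //; case: eqP => // si0.
  by rewrite -si0 mem_nth in s0.
apply/signed_sumsetP; exists l; split.
- move=> x; rewrite As inE /l; case: eqP => [_ _|_ /= xs].
    by rewrite /l0; case: eqP; [right; left|right; right].
  have /v1 : nth 0 v (index x s) \in v by rewrite mem_nth // szv index_mem.
  by rewrite !inE => /or3P[] /eqP ->; [left|right; left|right; right].
- rewrite (perm_big _ AsP) big_cons.
  have -> : \sum_(x <- s) `|l x| = (count (predC1 (0 : int)) v)%:Z.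
    transitivity (\sum_(z <- v) `|z|); first by rewrite -lE big_map.
    elim: (v) v1 => [|z w IHw] zw; first by rewrite big_nil.
    rewrite big_cons IHw => [/=|t tw]; last by rewrite zw // inE tw orbT.
    have /[!inE] : z \in z :: w by rewrite inE eqxx.
    by move=> /zw/[!inE]; case/or3P => /eqP ->; lia.
  rewrite /l eqxx /l0; move: (count _ v) vc => n; case: eqP => [->|] /=; lia.
- by rewrite (perm_big _ AsP) big_cons /= mulr0 add0r -dot_map lE.
Qed.

(** Each positive sum brings its negative, so a chain counts twice. The 0 at the end of the sorted
    list encodes positivity. For concrete vectors [dot] reduces to linear forms, and the ordering is
    left to [lia]. *)
Lemma chain_le_nssums h s (vs : seq (seq int)) :
    all (fun v => (size v == size s) && sign_vector h v) vs ->
    sorted >%R (rcons [seq dot v s | v <- vs] 0) ->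
  (2 * size vs <= nssums h s)%N.
Proof.
move=> /allP vsP; set t := map _ vs => t_sorted.
have t_gt0 : all (> 0) t.
  case: (lastP t) t_sorted => // t' x; rewrite -cats1 => {}t_sorted.
  elim: (rcons t' x) t_sorted => //= y t1 IHt yt.
  rewrite IHt ?(path_sorted yt) // andbT.
  have := order_path_min (rev_trans lt_trans) yt.
  by rewrite all_cat /= => /and3P[].
have tU : uniq t.
  move: (sorted_uniq (rev_trans lt_trans) ltxx t_sorted).
  by rewrite rcons_uniq => /andP[].
have ts : {subset t <= ssums h s}.
  move=> _ /mapP[v /vsP /andP[/eqP szv vh] ->].
  by apply/ssumsP; exists v; split.
have := @size_le_nssums h s (t ++ map -%R t).
rewrite size_cat !size_map mul2n -addnn; apply.
  rewrite cat_uniq tU map_inj_uniq ?tU ?andbT; last exact: oppr_inj.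
  apply/hasPn => _ /mapP[x /(allP t_gt0) x_gt0 ->].
  by apply/negP => /(allP t_gt0); rewrite /= oppr_gt0 ltNge ltW.
move=> x; rewrite mem_cat => /orP[/ts //|/mapP[y /ts ys ->]].
by rewrite ssums_opp.
Qed.

(* Base case: four positive elements *)
(* The chains of positive sums given to this tactic were found by computer
   search. *)
Tactic Notation "by_chain" uconstr(vs) :=
  lazymatch goal with small : is_true (nssums ?h ?s <= ?n)%N |- _ =>
    exfalso; refine (notF (leq_trans (@chain_le_nssums h s vs isT _) small));
    rewrite /=; lia
  end.

Fixpoint multiples (c : int) (m : nat) : seq int :=
  if m is m'.+1 then c * m%:Z :: multiples c m' else [::].

(** The bound is h (2m + 1 - h) + 1 with m = 4. A strict inequality in any of three comparisons
    yields 10 positive sums, hence 20 sums; what remains is c = a + b, b = 2a and d = a + c. *)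
Lemma inverse_three_four (a b c d : int) :
    0 < a -> a < b -> b < c -> c < d ->
    (nssums 3 [:: d; c; b; a] <= 19)%N ->
  exists q, [:: d; c; b; a] = multiples q 4.
Proof.
move=> a_gt0 ab bc cd small_nssums.
have [E0|E0|E0] := ltgtP (a + b) c.
- by_chain [:: [:: 1; 1; 1; 0]; [:: 1; 1; 0; 1]; [:: 1; 1; 0; 0];
     [:: 1; 0; 1; 1]; [:: 1; 0; 1; 0]; [:: 1; 0; 0; 1]; [:: 1; 0; 0; -1];
     [:: 1; -1; 1; 0]; [:: 1; -1; 0; 1]; [:: 1; -1; 0; 0]].
- by_chain [:: [:: 1; 1; 1; 0]; [:: 1; 1; 0; 1]; [:: 1; 0; 1; 1];
     [:: 1; 1; 0; 0]; [:: 1; 0; 1; 0]; [:: 1; 0; 0; 1]; [:: 1; 1; -1; 0];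
     [:: 1; 0; -1; 1]; [:: 1; -1; 0; 1]; [:: 1; 0; -1; 0]].
have [E1|E1|E1] := ltgtP (2 * a) b.
- by_chain [:: [:: 1; 1; 1; 0]; [:: 1; 1; 0; 1]; [:: 1; 0; 1; 1];
     [:: 1; 0; 1; 0]; [:: 1; 0; 1; -1]; [:: 1; 0; 0; 1]; [:: 0; 1; 0; 1];
     [:: 0; 0; 1; 1]; [:: 0; 1; 0; -1]; [:: 0; 1; -1; 1]].
- by_chain [:: [:: 1; 1; 1; 0]; [:: 1; 1; 0; 1]; [:: 1; 0; 1; 1];
     [:: 1; 0; 1; 0]; [:: 1; 0; 0; 1]; [:: 0; 1; 0; 1]; [:: 0; 1; 1; -1];
     [:: 0; 0; 1; 1]; [:: 0; 1; -1; 1]; [:: 0; 1; 0; -1]].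
have [E2|E2|E2] := ltgtP (a + c) d.
- by_chain [:: [:: 1; 1; 1; 0]; [:: 1; 1; 0; 1]; [:: 1; 0; 1; 1];
     [:: 1; 0; 1; 0]; [:: 0; 1; 1; 1]; [:: 0; 1; 1; 0]; [:: 0; 1; 0; 1];
     [:: 0; 0; 1; 1]; [:: 0; 1; -1; 1]; [:: 0; 1; -1; 0]].
- by_chain [:: [:: 1; 1; 1; 0]; [:: 1; 1; 0; 1]; [:: 1; 0; 1; 1];
     [:: 0; 1; 1; 1]; [:: 1; 0; 1; 0]; [:: 0; 1; 1; 0]; [:: 1; 0; 0; 1];
     [:: 0; 1; 0; 1]; [:: 0; 0; 1; 1]; [:: 1; 0; -1; 1]].
by exists a; congr [:: _; _; _; _]; lia.

Qed.

(** Here chains of 11 positive sums exceed the bound. The branch a + b < c leaves c = 2b, b = 2a and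
    d = b + c, the exceptional set; a + b > c leaves nothing; a + b = c leaves the progression. *)
Lemma inverse_four_four (a b c d : int) :
    0 < a -> a < b -> b < c -> c < d ->
    (nssums 4 [:: d; c; b; a] <= 21)%N ->
  (exists q, [:: d; c; b; a] = multiples q 4) \/
  (exists q, [:: d; c; b; a] = [:: 6 * q; 4 * q; 2 * q; q]).
Proof.
move=> a_gt0 ab bc cd small_nssums.
have [E0|E0|E0] := ltgtP (a + b) c.
- have [E1|E1|E1] := ltgtP (2 * b) c.
  + by_chain [:: [:: 1; 1; 1; 1]; [:: 1; 1; 1; 0]; [:: 1; 1; 0; 1];
       [:: 1; 1; -1; 1]; [:: 1; 1; -1; 0]; [:: 1; 1; -1; -1]; [:: 1; 0; 1; -1];
       [:: 1; 0; -1; 1]; [:: 1; -1; 1; 1]; [:: 1; -1; 1; 0]; [:: 1; -1; 0; 1]].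
  + by_chain [:: [:: 1; 1; 1; 1]; [:: 1; 1; 1; 0]; [:: 1; 1; 1; -1];
       [:: 1; 0; 1; 1]; [:: 1; 1; -1; 1]; [:: 1; 1; -1; 0]; [:: 1; 1; -1; -1];
       [:: 1; -1; 1; 1]; [:: 1; -1; 1; 0]; [:: 1; -1; 1; -1];
       [:: 1; 0; -1; -1]].
  have [E2|E2|E2] := ltgtP (2 * a) b.
  + by_chain [:: [:: 1; 1; 1; 1]; [:: 1; 1; 1; 0]; [:: 1; 1; 1; -1];
       [:: 1; 1; 0; 1]; [:: 1; 1; 0; -1]; [:: 1; 0; 1; 1]; [:: 1; 1; -1; 0];
       [:: 1; 0; 1; -1]; [:: 1; -1; 1; 1]; [:: 1; -1; 1; 0];
       [:: 1; -1; 1; -1]].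
  + by_chain [:: [:: 1; 1; 1; 1]; [:: 1; 1; 1; 0]; [:: 1; 1; 0; 1];
       [:: 1; 1; 1; -1]; [:: 1; 0; 1; 1]; [:: 1; 1; 0; -1]; [:: 1; 1; -1; 0];
       [:: 1; 0; 1; -1]; [:: 1; -1; 1; 1]; [:: 1; -1; 1; 0]; [:: 1; -1; 0; 1]].
  have [E3|E3|E3] := ltgtP (b + c) d.
  + by_chain [:: [:: 1; 1; 1; 1]; [:: 1; 1; 1; 0]; [:: 1; 1; 0; 1];
       [:: 1; 0; 1; 1]; [:: 1; 1; -1; 0]; [:: 1; 0; 1; -1]; [:: 1; -1; 1; 1];
       [:: 1; -1; 1; 0]; [:: 1; -1; 0; 1]; [:: 1; -1; -1; 1];
       [:: 1; -1; -1; 0]].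
  + by_chain [:: [:: 1; 1; 1; 1]; [:: 1; 1; 1; 0]; [:: 1; 1; 0; 1];
       [:: 1; 0; 1; 1]; [:: 0; 1; 1; 1]; [:: 1; 0; 1; -1]; [:: 0; 1; 1; -1];
       [:: 1; -1; 1; 1]; [:: 0; 1; -1; 1]; [:: -1; 1; 1; 1]; [:: -1; 1; 1; 0]].
  by right; exists a; congr [:: _; _; _; _]; lia.
- have [E1|E1|E1] := ltgtP (2 * a) c.
  + by_chain [:: [:: 1; 1; 1; 1]; [:: 1; 1; 1; 0]; [:: 1; 1; 0; 1];
       [:: 1; 0; 1; 1]; [:: 1; 1; 0; -1]; [:: 1; 0; 1; -1]; [:: 1; -1; 1; 1];
       [:: 1; 1; -1; -1]; [:: 1; 0; -1; 1]; [:: 1; -1; 0; 1];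
       [:: 0; -1; 1; 1]].
  + by_chain [:: [:: 1; 1; 1; 1]; [:: 1; 1; 1; 0]; [:: 1; 1; 0; 1];
       [:: 1; 0; 1; 1]; [:: 1; 1; 1; -1]; [:: 1; 1; -1; 1]; [:: 1; 1; 0; -1];
       [:: 1; 1; -1; 0]; [:: 1; 0; -1; 1]; [:: 1; -1; 0; 1]; [:: 0; -1; 1; 1]].
  by_chain [:: [:: 1; 1; 1; 1]; [:: 1; 1; 1; 0]; [:: 1; 1; 0; 1];
     [:: 1; 0; 1; 1]; [:: 1; 1; -1; 1]; [:: 1; 1; 0; -1]; [:: 1; -1; 1; 1];
     [:: 1; 0; -1; 1]; [:: 1; -1; 0; 1]; [:: 1; -1; 1; -1]; [:: 0; -1; 1; 1]].
have [E1|E1|E1] := ltgtP (2 * a) b.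
- by_chain [:: [:: 1; 1; 1; 1]; [:: 1; 1; 1; 0]; [:: 1; 1; 1; -1];
     [:: 1; 1; 0; 1]; [:: 1; 0; 1; 1]; [:: 1; 1; 0; -1]; [:: 1; 1; -1; 1];
     [:: 1; 1; -1; 0]; [:: 1; -1; 1; 1]; [:: 1; -1; 1; 0]; [:: 1; 0; -1; 1]].
- by_chain [:: [:: 1; 1; 1; 1]; [:: 1; 1; 1; 0]; [:: 1; 1; 0; 1];
     [:: 1; 1; 1; -1]; [:: 1; 0; 1; 1]; [:: 1; 1; -1; 1]; [:: 1; 1; 0; -1];
     [:: 1; 1; -1; 0]; [:: 1; 0; 1; -1]; [:: 1; -1; 1; 1]; [:: 1; 0; -1; 1]].
have [E2|E2|E2] := ltgtP (a + c) d.
- by_chain [:: [:: 1; 1; 1; 1]; [:: 1; 1; 1; 0]; [:: 1; 1; 0; 1];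
     [:: 1; 0; 1; 1]; [:: 1; 1; -1; 1]; [:: 1; 1; -1; 0]; [:: 1; -1; 1; 1];
     [:: 1; 0; -1; 1]; [:: 1; -1; 0; 1]; [:: 1; 0; -1; -1]; [:: 1; -1; -1; 1]].
- by_chain [:: [:: 1; 1; 1; 1]; [:: 1; 1; 1; 0]; [:: 1; 1; 0; 1];
     [:: 1; 0; 1; 1]; [:: 0; 1; 1; 1]; [:: 1; 1; -1; 1]; [:: 1; 1; -1; 0];
     [:: 0; 1; 1; -1]; [:: 1; -1; 1; 1]; [:: -1; 1; 1; 1]; [:: 0; 1; -1; 1]].
by left; exists a; congr [:: _; _; _; _]; lia.

Qed.

(** * Adding a largest element when [h < m] *)

Lemma ssums_le_top h (s : seq int) y :
    sorted >%R s -> all (> 0) s -> y \in ssums h s ->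
  y <= \sum_(x <- take h s) x.
Proof.
elim: s h y => [|b s IHs] h y.
  by case: h => [|[|h]]; rewrite //= inE => _ _ /eqP ->; rewrite big_nil.
move=> /[dup] /path_sorted s_sorted /(order_path_min (rev_trans lt_trans)).
move=> /allP s_lt /andP[b_gt0 s_gt0].
case: h => [|h]; first by rewrite ssums0 inE big_nil => /eqP ->.
rewrite ssums_consS -[take _ _]/(b :: take h s) big_cons.
move=> /or3P[] /IHs -/(_ s_sorted s_gt0) y_le.
(* Here [b] has sign 0: the sum over [take h.+1 s] grows when [b] replaces its last element, or is
   added if [s] is too short. *)
- apply: (le_trans y_le).
  have [h_lt|s_le] := ltnP h (size s); last first.
    by rewrite !take_oversize ?(leqW s_le) // lerDr ltW.
  rewrite (take_nth 0) // -cats1 big_cat big_seq1 /= addrC lerD2r ltW //.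
  by apply: s_lt; rewrite mem_nth.
- by rewrite -lerBlDl.
- by move: (\sum_(_ <- _) _) y_le => top; lia.
Qed.

Lemma mem_ssums_subseq h (t s : seq int) :
  subseq t s -> (size t <= h <= (size t).+1)%N -> \sum_(x <- t) x \in ssums h s.
Proof.
elim: s h t => [|b s IHs] h t.
  by move=> /eqP ->; case: h => [|[|h]]; rewrite // big_nil inE.
case: h => [|h]; first by case: t => //; rewrite ssums0 big_nil inE.
rewrite ssums_consS; case: t => [_ /= hP|c t /=].
  by rewrite (IHs _ [::]) // sub0seq.
case: eqP => [->|_] ts hP; last by rewrite (IHs _ (c :: t)).
by rewrite big_cons addrAC subrr add0r (IHs h t) ?orbT.
Qed.

(** No sum of [s] exceeds in absolute value the sum [top] of the [h] largest elements. Replacing one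
    of these by [x] gives [h] distinct sums above [top], and their negatives give [h] more. *)
Lemma nssums_cons_lt h x (s : seq int) :
    sorted >%R (x :: s) -> all (> 0) (x :: s) -> (h <= size s)%N ->
  (nssums h s + 2 * h <= nssums h (x :: s))%N.
Proof.
move=> xs_sorted /= /andP[x_gt0 s_gt0] h_le.
have s_lt := allP (order_path_min (rev_trans lt_trans) xs_sorted).
have s_sorted := path_sorted xs_sorted.
pose t := take h s; pose top := \sum_(y <- t) y.
have top_ge y : y \in ssums h s -> y <= top by exact: ssums_le_top.
have tU : uniq t.
  by rewrite take_uniq // (sorted_uniq (rev_trans lt_trans) ltxx).
have t_lt y : y \in t -> 0 < x - y.
  by move=> /mem_take /s_lt; rewrite subr_gt0.
have top_ge0 : 0 <= top.
  by rewrite /top big_seq sumr_ge0 // => y /mem_take /(allP s_gt0) /ltW.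
pose new := [seq x + top - y | y <- t].
have newU : uniq new by rewrite map_inj_uniq // => y z; lia.
have new_gt z : z \in new -> top < z by case/mapP => y /t_lt yx ->; lia.
have new_mem z : z \in new -> z \in ssums h (x :: s).
  case/mapP => y yt ->.
  have -> : x + top - y = \sum_(z <- x :: rem y t) z.
    by rewrite big_cons /top (perm_big _ (perm_to_rem yt)) big_cons /=; ring.
  apply: mem_ssums_subseq.
    by rewrite /= eqxx (subseq_trans (rem_subseq _ _)) ?take_subseq.
  rewrite /= size_rem // prednK ?size_takel ?leqnn ?leqnSn //.
  by rewrite -(size_takel h_le) -/t; case: (t) yt.
have := @size_le_nssums h (x :: s)
  (undup (ssums h s) ++ new ++ [seq - z | z <- new]).
rewrite !size_cat !size_map size_takel // mul2n -addnn; apply.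
  rewrite !cat_uniq undup_uniq newU map_inj_uniq ?newU ?andbT; last first.
    exact: oppr_inj.
  rewrite /=; apply/andP; split; apply/hasPn => z; last first.
    by case/mapP => z' /new_gt z'_gt ->; apply/negP => /new_gt; lia.
  rewrite mem_undup mem_cat => /orP[/new_gt|/mapP[z' /new_gt z'_gt ->]].
    by rewrite ltNge; apply: contra => /top_ge.
  by rewrite ssums_opp; apply/negP => /top_ge; lia.
move=> z; rewrite 2!mem_cat mem_undup => /or3P[|/new_mem //|].
  by case: (h) => [|h']; rewrite ?ssums0 // ssums_consS => ->.
by case/mapP => z' /new_mem z'_in ->; rewrite ssums_opp.
Qed.

(** * Adding a largest element when [h = m]: offsets *)

(* The sums of [s] with at most one zero sign, counted from the smallest. *)
Definition offset (s : seq int) (o : int) : bool :=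
  o - \sum_(x <- s) x \in ssums (size s) s.

(** Giving [x] the sign 1 embeds the sums of [s], with values at least x - [top]. The sum with
    offset [o] is o - (x + [top]), which lies below them as soon as o < 2x. *)
Lemma nssums_cons_offsets x (s N : seq int) :
    sorted >%R (x :: s) -> all (> 0) (x :: s) ->
    uniq N -> {in N, forall o, o < 2 * x /\ offset (x :: s) o} ->
  (nssums (size s) s + size N <= nssums (size s).+1 (x :: s))%N.
Proof.
move=> xs_sorted /= /andP[x_gt0 s_gt0] NU NP.
have s_sorted := path_sorted xs_sorted.
pose top := \sum_(y <- s) y.
have top_ge y : y \in ssums (size s) s -> - top <= y.
  rewrite -ssums_opp => /ssums_le_top; rewrite take_size -/top.
  by move=> /(_ s_sorted s_gt0); lia.
have := @size_le_nssums (size s).+1 (x :: s)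
  ([seq x + y | y <- undup (ssums (size s) s)] ++ [seq o - (x + top) | o <- N]).
rewrite size_cat !size_map; apply.
  rewrite cat_uniq map_inj_uniq ?undup_uniq; last exact: addrI.
  rewrite map_inj_uniq ?NU ?andbT /=; last by move=> y z; lia.
  apply/hasPn => _ /mapP[o /NP[o_lt _] ->]; apply/negP => /mapP[y].
  by rewrite mem_undup => /top_ge; lia.
move=> z; rewrite mem_cat => /orP[] /mapP[y].
  by rewrite mem_undup ssums_consS => ys ->; rewrite addrAC subrr add0r ys orbT.
by move=> /NP[_ y_off] ->; move: y_off; rewrite /offset big_cons.
Qed.

(** Starting from all signs -1, turning the signs on [F] to 1 adds each element of [F] twice. *)
Lemma offset_double (s F : seq int) :
    uniq s -> uniq F -> {subset F <= s} -> offset s (2 * \sum_(x <- F) x).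
Proof.
move=> sU FU Fs; rewrite /offset.
have FE : perm_eq F [seq x <- s | x \in F].
  apply: uniq_perm; rewrite ?filter_uniq // => x; rewrite mem_filter.
  by case: (boolP (x \in F)) => // /Fs ->.
have -> : 2 * \sum_(x <- F) x - \sum_(x <- s) x
        = \sum_(x <- s) (if x \in F then 1 else -1) * x.
  rewrite (perm_big _ FE) big_filter /= big_mkcond mulr_sumr -sumrB.
  by apply: eq_bigr => x _; case: ifP => _; ring.
apply: mem_ssums_fun => [x _|]; first by case: ifP.
rewrite (eq_count (a2 := predT)) ?count_predT ?leqnn ?leqnSn // => x /=.
by case: ifP.
Qed.

(** As for [offset_double], with the sign of [b] raised from -1 to 0, the one zero sign allowed. *)
Lemma offset_drop_double (s F : seq int) b :
    uniq s -> uniq F -> {subset F <= s} -> b \in s -> b \notin F ->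
  offset s (b + 2 * \sum_(x <- F) x).
Proof.
move=> sU FU Fs bs bF; rewrite /offset.
have FE : perm_eq F [seq x <- s | x \in F].
  apply: uniq_perm; rewrite ?filter_uniq // => x; rewrite mem_filter.
  by case: (boolP (x \in F)) => // /Fs ->.
have -> : b + 2 * \sum_(x <- F) x - \sum_(x <- s) x
    = \sum_(x <- s) (if x == b then 0 else if x \in F then 1 else -1) * x.
  have bE : b = \sum_(x <- s) if x == b then x else 0.
    by rewrite -big_mkcond -big_filter filter_pred1_uniq // big_seq1.
  rewrite {1}bE [X in 2 * X](perm_big _ FE) big_filter [X in 2 * X]big_mkcond.
  rewrite mulr_sumr -big_split -sumrB; apply: eq_bigr => x _ /=.
  by case: eqP => [->|_]; rewrite ?(negPf bF); [ring|case: ifP => _; ring].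
apply: mem_ssums_fun => [x _|]; first by case: ifP => // _; case: ifP.
rewrite (eq_count (a2 := predC (pred1 b))); last first.
  by move=> x /=; have [//|_] := eqVneq x b; case: ifP.
by rewrite -(count_predC (pred1 b) s) count_uniq_mem // bs leqnSn leqnn.
Qed.

(** * Finding enough offsets by a parity argument *)

(* Membership hypotheses are opaque atoms for [lia], which slow it down
   exponentially. *)
Ltac int_lia :=
  repeat match goal with
  | H : is_true (_ \in _) |- _ => clear H
  | H : is_true (_ \notin _) |- _ => clear H
  end; lia.

Lemma ltz_exp2 (n : nat) : n%:Z < 2 ^+ n.
Proof. by elim: n => // n IHn; rewrite exprS; lia. Qed.

(* Think of [ev] as the even integers: [o] is the largest odd element of [s].
   Let [2 ^ k * o] be its last double in [s]. If [k >= 2], then with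
   [v := 2 ^ (k - 2) * o] the offset [2 * (2 * v) + 2 * v] is not confined. If
   [k = 1], an element [b < o] forces a larger one, below [o], and an element
   [e > o] other than [2 * o] forces one closer to [2 * o]: infinite descent. *)
Lemma offsets_not_confined (s : seq int) (x o c : int) (ev : {pred int}) :
    {in ev &, forall a b, a + b \in ev} ->
    {in ev &, forall a b, a - b \in ev} ->
    {in s, forall b, 2 * b \in ev} ->
    o \in s -> o \notin ev -> {in s, forall b, b \notin ev -> b <= o} ->
    {in s, forall b, 0 < b <= x} ->
    2 * o \in s -> c \in s -> c != o -> c != 2 * o ->
    {in s, forall b, b != o -> 2 * b + o < 2 * x -> 2 * b \in s} ->
    (forall u, u < 2 * x ->
       (exists b d, [/\ b \in s, d \in s, b != d
                       & u = 2 * b + 2 * d \/ u = b + 2 * d]) ->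
       [\/ u \in s, exists2 d, d \in s & u = 2 * d
         | exists2 d, d \in s & u = o + 2 * d]) ->
  False.
Proof.
move=> evD evB ev2 os oNev o_max s_bnd o2s cs c_o c_2o closure confined.
have /andP[o_gt0 o_le] := s_bnd o os; have /andP[_ o2_le] := s_bnd _ o2s.
have ev_o d e : d \in ev -> 2 * e \in ev -> d <> o + 2 * e.
  move=> dev eev dE; case/negP: oNev.
  by rewrite (_ : o = d - 2 * e) ?evB // dE addrK.
have gt_o b : b \in s -> o < b -> b \in ev.
  by move=> bs; apply: contraTT => /(o_max b bs); rewrite -leNgt.
have [k k_gt0 [pow_in pow_out]] : exists2 k, (0 < k)%N &
    (forall j, (j <= k)%N -> 2 ^+ j * o \in s) /\ 2 ^+ k.+1 * o \notin s.
  pose out j := 2 ^+ j.+1 * o \notin s.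
  have ex_out : exists j, out j.
    exists `|x|%N; apply/negP => /s_bnd /andP[_].
    rewrite leNgt (le_lt_trans (ler_norm x)) // -abszE exprS -mulrA.
    have := ltz_exp2 `|x|; have : 0 <= 2 ^+ `|x| :> int by rewrite exprn_ge0.
    move: (2 ^+ _) => y; nia.
  case: (ex_minnP ex_out) => k k_out k_min; exists k.
    by case: k k_out {k_min}; rewrite // /out expr1 o2s.
  split=> // -[|j] jk; first by rewrite mul1r.
  by apply: contraTT jk => /k_min; rewrite -leqNgt.
case: k k_gt0 pow_in pow_out => [//|[|k]] _ pow_in pow_out.
  (* [4 * o] is missing from [s], so [closure] must fail to apply to [2 * o]. *)
  have o4 : 2 * x <= 5 * o.
    rewrite leNgt; apply: contra pow_out => x_gt.
    rewrite (_ : _ * o = 2 * (2 * o)); last by ring.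
    by apply: closure => //; int_lia.
  (* Descent on the distance to [o]: the next element is 2b if 2b < o, and the midpoint of [b] and
     [o] otherwise. *)
  have below (n : nat) b : b \in s -> b < o -> `|o - b| <= n%:Z -> False.
    elim: n b => [|n IHn] b bs b_lt bn; first by int_lia.
    have /andP[b_gt0 _] := s_bnd b bs.
    have b2s : 2 * b \in s by apply: closure => //; int_lia.
    have [b2_lt|b2_gt|b2E] := ltgtP (2 * b) o.
    - by apply: (IHn (2 * b)) => //; int_lia.
      have bos : o + b \in s.
        case: (confined (2 * o + 2 * b)) => [|||[d ds dE]|[d ds dE]].
        - by int_lia.
        - by exists o, b; split=> //; [int_lia|left].
        - by move=> /s_bnd; int_lia.
        - by rewrite (_ : o + b = d) //; int_lia.
        - by case: (ev_o (2 * o + 2 * b) d) => //; rewrite ?evD ?ev2.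
      have bo_ev : o + b \in ev by apply: gt_o => //; int_lia.
      have b2o_ev : b + 2 * o \notin ev.
        apply: contra oNev => b2o_ev.
        by rewrite (_ : o = b + 2 * o - (o + b)) ?evB //; int_lia.
      case: (confined (b + 2 * o)) => [|||[d ds dE]|[d ds dE]].
      + by int_lia.
      + by exists b, o; split=> //; [int_lia|right].
      + by move=> b2os; case/negP: b2o_ev; apply: gt_o => //; int_lia.
      + by case/negP: b2o_ev; rewrite dE ev2.
      + by apply: (IHn d) => //; int_lia.
    by case/negP: oNev; rewrite -b2E ev2.
  (* Descent on the distance to [2 * o], passing to the midpoint of [e] and [2 * o]. *)
  have above (n : nat) e : e \in s -> o < e -> e != 2 * o ->
      `|e - 2 * o| <= n%:Z -> False.
    elim: n e => [|n IHn] e es e_gt e_2o en; first by int_lia.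
    have /andP[e_gt0 e_le] := s_bnd e es.
    case: (confined (e + 2 * o)) => [|||[d ds dE]|[d ds dE]].
    - by int_lia.
    - by exists e, o; split=> //; [int_lia|right].
    - by move=> /s_bnd; int_lia.
    - by apply: (IHn d) => //; int_lia.
    - by case: (ev_o (e + 2 * o) d) => //; rewrite ?evD ?ev2 ?gt_o.
  have [c_lt|c_gt|/eqP] := ltgtP c o; last by rewrite (negPf c_o).
    by apply: (below (absz (o - c)%R) c); rewrite // abszE.
  by apply: (above (absz (c - 2 * o)%R) c cs c_gt c_2o); rewrite abszE.
(* The last exponent is now written [k.+2], so [4 * v] is the last double of [o] in [s]. *)
pose v := 2 ^+ k * o.
have v_ge : o <= v by rewrite /v ler_peMl ?(ltW o_gt0) // exprn_ege1.
have vs : v \in s by apply: pow_in; lia.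
have v2s : 2 * v \in s by rewrite /v mulrA -exprS; apply: pow_in; lia.
have v4s : 4 * v \in s.
  by rewrite (_ : 4 * v = 2 ^+ k.+2 * o) ?pow_in // /v !exprS; ring.
have v8 : 2 * x <= 8 * v + o.
  rewrite leNgt; apply: contra pow_out => x_gt.
  rewrite (_ : _ * o = 2 * (4 * v)); last by rewrite /v !exprS; ring.
  by apply: closure => //; int_lia.
have /andP[_ v4_le] := s_bnd _ v4s.
case: (confined (2 * (2 * v) + 2 * v)) => [|||[d ds dE]|[d ds dE]].
- by int_lia.
- by exists (2 * v), v; split=> //; [int_lia|left].
- by move=> /s_bnd; int_lia.
(* Here d = 3v, so [closure] would put 6v, which exceeds [x], into [s]. *)
- have : 2 * d \in s by apply: closure => //; int_lia.
  by move=> /s_bnd; int_lia.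
- by case: (ev_o (2 * (2 * v) + 2 * v) d) => //; rewrite ?evD ?ev2.
Qed.

(* [d] is the least power of 2 that does not divide all of [s]; its multiples
   play the role of the even integers. *)
Lemma exists_even_class (s : seq int) :
    s != [::] -> all (> 0) s ->
  exists2 d : int, {in s, forall b, (d %| 2 * b)%Z}
                 & ~~ all (fun b => (d %| b)%Z) s.
Proof.
move=> s_neq0 s_gt0; pose P k := all (fun b => (2 ^+ k %| b)%Z) s.
have exP : exists k, P k by exists 0%N; apply/allP => b _; rewrite expr0 dvd1z.
have [x xs] : exists x, x \in s.
  by case: (s) s_neq0 => // x t; exists x; apply: mem_head.
have P_bnd k : P k -> (k <= `|x|)%N.
  move=> /allP/(_ x xs) /dvdzP[q xE]; have x_gt0 := allP s_gt0 x xs.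
  have q_gt0 : 0 < q by move: x_gt0; rewrite /= xE pmulr_lgt0 ?exprn_gt0.
  rewrite -lez_nat abszE gtr0_norm // ltW // (lt_le_trans (ltz_exp2 k)) // xE.
  by rewrite ler_peMl // exprn_ge0.
case: (ex_maxnP exP P_bnd) => k /allP k_dvd k_max; exists (2 ^+ k.+1).
  by move=> b /k_dvd kb; rewrite exprS dvdz_mul // dvdzz.
by apply/negP => /k_max; rewrite ltnn.
Qed.

(* The offsets 0, b and 2 b, for b in [x :: s], would be enough if they were
   distinct. With [o] the largest odd element, each coincidence 2 b = b' is made
   up for by the offset o + 2 b, which is odd and larger than all odd elements,
   except when b = o; [offsets_not_confined] then provides one more. *)
Lemma many_offsets x (s : seq int) :
    sorted >%R (x :: s) -> all (> 0) (x :: s) -> (1 < size s)%N ->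
  exists N : seq int,
    [/\ uniq N, {in N, forall o, o < 2 * x /\ offset (x :: s) o}
      & (2 * (size s).+1 <= size N)%N].
Proof.
set B := x :: s => B_sorted B_gt0 s_gt1.
have BU : uniq B by rewrite (sorted_uniq (rev_trans lt_trans) ltxx).
have s_lt := allP (order_path_min (rev_trans lt_trans) B_sorted).
have B_bnd b : b \in B -> 0 < b <= x.
  move=> bB; apply/andP; split; first exact: (allP B_gt0).
  by move: bB; rewrite inE => /predU1P[->|/s_lt/ltW].
have sB b : b \in s -> b \in B by rewrite inE orbC => ->.
have [e even2 /allPn[o0 o0B o0Nev]] :=
  exists_even_class (isT : B != [::]) B_gt0.
have [o [oB oNev o_max]] : exists o, [/\ o \in B, o \notin dvdz e &
    {in B, forall b, b \notin dvdz e -> b <= o}].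
  pose F := [seq b <- B | b \notin dvdz e].
  have memF b : (b \in F) = (b \notin dvdz e) && (b \in B).
    by rewrite mem_filter.
  have : sorted >%R F.
    by apply: sorted_filter B_sorted; apply: rev_trans lt_trans.
  case: F memF => [memF _|o t memF].
    by have := memF o0; rewrite o0Nev o0B.
  move=> /(order_path_min (rev_trans lt_trans))/allP t_lt; exists o.
  have := memF o; rewrite inE eqxx => /esym/andP[oNev oB]; split=> // b bB bNev.
  by have := memF b; rewrite bB bNev inE => /predU1P[-> //|/t_lt/ltW].
have /andP[o_gt0 o_le] := B_bnd o oB.
have offF F : uniq F -> {subset F <= B} -> offset B (2 * \sum_(b <- F) b).
  exact: offset_double.
have offdF F b : uniq F -> {subset F <= B} -> b \in B -> b \notin F ->
  offset B (b + 2 * \sum_(b <- F) b) by move=> *; apply: offset_drop_double.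
have off0 : offset B 0 by have := offF [::] isT; rewrite big_nil mulr0; apply.
have off1 b : b \in B -> offset B b.
  by move=> bB; have := offdF [::] b isT; rewrite big_nil mulr0 addr0; apply.
have off2 b : b \in B -> offset B (2 * b).
  move=> bB; have := offF [:: b] isT; rewrite big_seq1; apply.
  by move=> y; rewrite inE => /eqP ->.
have off12 b d : b \in B -> d \in B -> b != d -> offset B (b + 2 * d).
  move=> bB dB bd; have := offdF [:: d] b isT; rewrite big_seq1 inE bd.
  by apply=> // y; rewrite inE => /eqP ->.
have off22 b d : b \in B -> d \in B -> b != d -> offset B (2 * b + 2 * d).
  move=> bB dB bd; have := offF [:: b; d]; rewrite big_cons big_seq1 /= mulrDr.
  by apply=> [|y]; rewrite !inE ?andbT // => /orP[] /eqP ->.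
(* [W] holds 0 and the doubles, [V] the elements of [B] not among them; [Y] indexes the odd offsets
   o + 2b below 2x. *)
pose W := 0 :: [seq 2 * b | b <- s]; pose V := [seq b <- B | b \notin W].
pose Y := [seq b <- B | (b != o) && (2 * b + o < 2 * x)].
pose N := W ++ V ++ [seq o + 2 * b | b <- Y].
have memY b : (b \in Y) = [&& b != o, 2 * b + o < 2 * x & b \in B].
  by rewrite mem_filter -andbA.
have YU : uniq Y by rewrite filter_uniq.
have evB : {in dvdz e &, forall a b, a - b \in dvdz e}.
  by move=> *; rewrite rpredB.
have ZNev b : b \in B -> o + 2 * b \notin dvdz e.
  move=> bB; apply: contra oNev => ev_ob.
  by rewrite -(addrK (2 * b) o) evB ?even2.
have NU : uniq N.
  rewrite !cat_uniq /= filter_uniq // !map_inj_uniq ?YU;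
    try by move=> ? ? /=; int_lia.
  rewrite (subseq_uniq (subseq_cons s x)) //= !andbT; apply/and3P; split.
  - by apply/mapP => -[b /sB/B_bnd]; int_lia.
  - apply/hasPn => y; rewrite mem_cat => /orP[|/mapP[b]].
      by rewrite mem_filter => /andP[].
    rewrite memY => /and3P[_ _ bB] ->; rewrite inE negb_or.
    apply/andP; split; first by have := B_bnd b bB; int_lia.
    by apply/mapP => -[d /sB dB dE]; case/negP: (ZNev b bB); rewrite dE even2.
  - apply/hasPn => y /mapP[b + ->] /=; rewrite memY => /and3P[_ _ bB].
    rewrite mem_filter negb_and; apply/orP; right; apply/negP => obB.
    by have := o_max _ obB (ZNev b bB); have := B_bnd b bB; int_lia.
have N_off : {in N, forall y, y < 2 * x /\ offset B y}.
  move=> y; rewrite !mem_cat inE -orbA.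
  case/or4P => [/eqP ->|/mapP[b bs ->]||/mapP[b + ->]].
  - by split=> //; have := B_bnd x; rewrite inE eqxx; int_lia.
  - by split; [have := s_lt b bs; int_lia|rewrite off2 ?sB].
  - rewrite mem_filter => /andP[_ yB].
    by split; [have := B_bnd y yB; int_lia|exact: off1].
  - rewrite memY => /and3P[bo b_lt bB].
    by split; [int_lia|rewrite off12 // eq_sym].
pose H := [seq b <- s | 2 * b \in B].
have HU : uniq H by rewrite filter_uniq // (subseq_uniq (subseq_cons s x)).
have sizeN : (size N + size H >= 2 * (size s).+1 + size Y)%N.
  have : (size [seq b <- B | b \in W] <= size H)%N.
    rewrite -(size_map ( *%R 2) H); apply: uniq_leq_size => [|b].
      exact: filter_uniq.
    rewrite mem_filter in_cons.
    move=> /andP[/predU1P[-> /B_bnd //|/mapP[d ds ->] dB]].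
    by apply: map_f; rewrite mem_filter dB.
  have := count_predC (mem W) B; rewrite -!size_filter -/V.
  rewrite !size_cat /= !size_map.
  rewrite -[size (filter (mem W) B)]/(size [seq b <- B | b \in W]).
  by int_lia.
have H_Y b : b \in H -> b != o -> b \in Y.
  rewrite mem_filter memY => /andP[b2B bs] bo; rewrite bo sB // andbT /=.
  (* Equality would make o = 2x - 2b even. *)
  rewrite lt_neqAle; apply/andP; split; last by have := B_bnd _ b2B; int_lia.
  apply: contra oNev => /eqP oE.
  have -> : o = 2 * x - 2 * b by int_lia.
  by apply: evB; apply: even2; [exact: mem_head|exact: sB].
have N_enough : (size H <= size Y)%N -> (2 * (size s).+1 <= size N)%N.
  by move=> HY; rewrite -(leq_add2r (size Y)) (leq_trans sizeN) // leq_add2l.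
have [o2B|o2NB] := boolP (2 * o \in B); last first.
  exists N; split=> //; apply: N_enough.
  apply: uniq_leq_size => // b bH; apply: H_Y => //.
  by apply: contraNneq o2NB => <-; move: bH; rewrite mem_filter => /andP[].
(* An element of [Y] outside [H] makes up for [o]. Without one, [closure] holds and a single offset
   may be missing. *)
have [/hasP[b bY b2NB]|/hasPn closure] :=
    boolP (has (fun b => 2 * b \notin B) Y).
  exists N; split=> //; apply: N_enough.
  rewrite (perm_size (perm_to_rem bY)).
  apply: (@uniq_leq_size _ H (o :: rem b Y)) => // d dH.
  rewrite inE mem_rem_uniq // inE; have [//|d_o] := eqVneq d o.
  rewrite H_Y // andbT; apply: contraNneq b2NB => <-.
  by move: dH; rewrite mem_filter => /andP[].
have sizeH : (size H <= (size Y).+1)%N.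
  apply: (@uniq_leq_size _ H (o :: Y)) => // b bH; rewrite inE.
  by have [//|/H_Y ->] := eqVneq b o.
(* Candidates for the missing offset are 2b + 2d and b + 2d with b and d distinct; if none is new,
   the offsets are confined. *)
pose ps := [seq p <- [seq (b, d) | b <- B, d <- B] | p.1 != p.2].
have memps b d : ((b, d) \in ps) = [&& b != d, b \in B & d \in B].
  rewrite mem_filter; congr (_ && _); apply/allpairsP/andP.
    by case=> -[b' d'] /= [? ? [-> ->]].
  by case=> bB dB; exists (b, d).
pose C := [seq 2 * p.1 + 2 * p.2 | p <- ps] ++ [seq p.1 + 2 * p.2 | p <- ps].
have C_off u : u \in C -> offset B u.
  rewrite mem_cat => /orP[] /mapP[[b d]];
    rewrite memps /= => /and3P[bd bB dB] ->.
    exact: off22.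
  exact: off12.
have [/hasP[u uC /andP[u_lt uN]]|/hasPn confined] :=
    boolP (has (fun u => (u < 2 * x) && (u \notin N)) C).
  exists (u :: N); split; [by rewrite /= uN| |]; last first.
    rewrite -(leq_add2r (size Y)) (leq_trans sizeN) //.
    have sizeS : size (u :: N) = (size N).+1 by [].
    by rewrite sizeS addSnnS leq_add2l.
  move=> y; rewrite inE => /predU1P[->|/N_off //]; split=> //; exact: C_off.
(* [B] has at least three elements, hence one besides [o] and [2 * o]. *)
have [/hasP[c cB /andP[c_o c_2o]]|/hasPn B_sub] :=
    boolP (has (fun c => (c != o) && (c != 2 * o)) B); last first.
  suff : (size B <= 2)%N by rewrite /= ltnS leqNgt s_gt1.
  apply: (@uniq_leq_size _ B [:: o; 2 * o]) => // b /B_sub.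
  by rewrite negb_and !negbK !inE.
exfalso; apply: (@offsets_not_confined B x o c (dvdz e)) => //.
- by move=> *; rewrite rpredD.
- move=> b bB bo b_lt; have := closure b.
  by rewrite memY bo b_lt bB negbK; apply.
- move=> u u_lt [b [d [bB dB bd uE]]].
  have uC : u \in C.
    rewrite mem_cat; apply/orP; case: uE => ->; [left|right];
      by apply/mapP; exists (b, d); rewrite // memps bd bB dB.
  have := confined u uC; rewrite u_lt negbK !mem_cat inE -orbA.
  case/or4P => [/eqP u0|/mapP[f fs ->]||/mapP[f + ->]].
  + by have := B_bnd b bB; have := B_bnd d dB; case: uE; int_lia.
  + by apply: Or32; exists f; rewrite ?sB.
  + by rewrite mem_filter => /andP[_ uB]; apply: Or31.
  + by rewrite memY => /and3P[_ _ fB]; apply: Or33; exists f.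
Qed.

(** * Sums of the multiples of [c] *)

(** For [h <= n], the sum of the [h] largest elements of [1, n]. *)
Fixpoint topsum (h n : nat) : nat :=
  if h is h'.+1 then (n + topsum h' n.-1)%N else 0%N.

Lemma topsum_mul2 h n : (h <= n)%N -> (2 * topsum h n = h * (2 * n + 1 - h))%N.
Proof.
by elim: h n => [//|h IHh] [//|n] hn; rewrite /= mulnDr IHh //; nia.
Qed.

Lemma topsumS h n : (h <= n)%N -> topsum h n.+1 = (topsum h n + h)%N.
Proof.
move=> hn; apply/eqP; rewrite -(eqn_pmul2l (isT : 0 < 2)%N) mulnDr.
by rewrite !topsum_mul2 ?leqW //; apply/eqP; nia.
Qed.

(** Induction on [n]: values beyond the smaller progression are reached by adding its next term. The
    value 0 is claimed only for [h > 2], since for nonzero c the sums of {c, 2c} with one or two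
    nonzero signs avoid 0. *)
Lemma mem_ssums_multiples c n h :
    (0 < h <= n)%N ->
  (forall t, (0 < t <= topsum h n)%N -> c * t%:Z \in ssums h (multiples c n)) /\
  ((2 < h)%N -> 0 \in ssums h (multiples c n)).
Proof.
elim: n h => [|n IHn] [|h] //=.
rewrite ltnS -[_ ++ _]/(ssums h.+1 (multiples c n.+1)) => hn.
have IH t : (0 < h)%N -> (0 < t <= topsum h n)%N ->
    c * t%:Z \in ssums h (multiples c n).
  by move=> h_gt0; have [|+ _] := IHn h; [rewrite h_gt0|apply].
have topsum_h := topsum_mul2 hn.
have [hn'|nh] := ltnP h n.
  have [IHt IH0] := IHn h.+1 hn'.
  split=> [t t_bnd|h_gt2]; rewrite ssums_consS ?IH0 //.
  have [t_le|t_gt] := leqP t (topsum h.+1 n); first by rewrite IHt //; lia.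
  have topsum_hS := topsum_mul2 hn'.
  have [h0|h_gt0] := posnP h.
    have -> : t = n.+1 by move: t_bnd t_gt; rewrite h0 /=; lia.
    by rewrite subrr h0 ssums0 inE orbT.
  have top_ge : (n.-1 <= topsum h n.-1)%N.
    by case: (h) h_gt0 => //= h' _; rewrite leq_addr.
  move: t_gt => /= t_gt; have t_gtS : (n.+1 < t)%N by lia.
  apply/or3P/Or32; rewrite -mulrBr subzn ?(ltnW t_gtS) //.
  by apply: IH => //; lia.
have {hn nh} hn : h = n by apply/eqP; rewrite eqn_leq hn.
subst h; have top0 : n = 0%N -> topsum n n = 0%N by move->.
split=> [t t_bnd|n_gt1].
  rewrite ssums_consS; have [t_gt|t_lt|<-] := ltgtP n.+1 t.
  - apply/or3P/Or32; rewrite -mulrBr subzn ?(ltnW t_gt) //.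
    by apply: IH; lia.
  - apply/or3P/Or32; rewrite -mulrBr -[_ - _]opprB subzn ?(ltnW t_lt) //.
    by rewrite mulrN ssums_opp; apply: IH; nia.
  (* Here t = n + 1, that is, n + 1 plus a zero sum of the smaller progression, except for n = 2,
     where 3 = 1 + 2. *)
  case: n IHn {IH topsum_h t_bnd top0} => [_|[_|[_|n IHn]]].
  - by rewrite subrr inE orbT.
  - by rewrite subrr inE orbT.
  - apply/or3P/Or31; rewrite (_ : c * _ = \sum_(y <- multiples c 2) y).
      by apply: mem_ssums_subseq => //; apply: subseq_refl.
    by rewrite !big_cons big_nil /=; ring.
  - by have [_ IH0] := IHn n.+3 (leqnn _); rewrite subrr IH0 // orbT.
rewrite ssums_consS; apply/or3P/Or33; rewrite add0r IH //; nia.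
Qed.

Lemma ssums_multiples_itv c n h (t : int) :
  (2 < h <= n)%N -> `|t| <= (topsum h n)%:Z ->
  c * t \in ssums h (multiples c n).
Proof.
move=> hn t_le; have [|int_t int_0] := @mem_ssums_multiples c n h; first by lia.
have [t_lt|t_gt|<-] := ltgtP 0 t; last by rewrite mulr0 int_0; lia.
  by rewrite -(gtr0_norm t_lt) -abszE int_t //; lia.
by rewrite -ssums_opp -mulrN -(ltr0_norm t_gt) -abszE int_t //; lia.
Qed.

Lemma size_multiples c n : size (multiples c n) = n.
Proof. by elim: n => //= n ->. Qed.

Lemma sum_multiples c n : \sum_(y <- multiples c n) y = c * (topsum n n)%:Z.
Proof.
elim: n => [|n IHn]; first by rewrite big_nil mulr0.
by rewrite /= big_cons IHn PoszD mulrDr.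
Qed.

(** * Extending an extremal set by a largest element *)

(** The sums without [x] fill an interval of multiples of [c]. Unless x = c (n + 1), the sums x + cj
    for the h + 1 largest j all miss it; with their negatives this is one pair too many. *)
Lemma last_multiple_lt c n h x :
    0 < c -> (2 < h <= n)%N -> c * n%:Z < x ->
    (nssums h (x :: multiples c n) <= 2 * topsum h n.+1 + 1)%N ->
  x = c * n.+1%:Z.
Proof.
move=> c_gt0 hn x_gt small; apply/eqP; apply: contraTT small => x_neq.
rewrite -ltnNge; case: h hn => // h hn.
have hn' : (h <= n)%N by lia.
have [top_h top_hS] := (topsum_mul2 hn', topsumS (andP hn).2).
(* [h] is now one less than in the statement, so [D] has h + 1 entries in terms of the latter. *)
pose D := [seq x + c * ((topsum h n)%:Z - i%:Z) | i <- iota 0 h.+2].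
pose I := [seq c * (i%:Z - (topsum h.+1 n)%:Z) |
  i <- iota 0 (2 * topsum h.+1 n).+1].
have top_ge : (h.+1 < topsum h n)%N by nia.
have topE : topsum h.+1 n.+1 = (n.+1 + topsum h n)%N by [].
have DP y : y \in D -> exists2 j, y = x + c * j &
    (topsum h n)%:Z - h.+1%:Z <= j <= (topsum h n)%:Z.
  case/mapP => i; rewrite mem_iota => i_lt ->.
  by exists ((topsum h n)%:Z - i%:Z) => //; lia.
have D_gt0 y : y \in D -> 0 < y by case/DP => j ->; nia.
have IP y : y \in I -> exists2 j, y = c * j & `|j| <= (topsum h.+1 n)%:Z.
  case/mapP => i; rewrite mem_iota => i_lt ->.
  by exists (i%:Z - (topsum h.+1 n)%:Z) => //; lia.
have DI y : y \in D -> y \notin I.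
  case/DP => j -> j_bnd; apply/negP => /IP[i iE i_bnd].
  have xE : x = c * (i - j) by rewrite mulrBr -iE addrK.
  (* The ranges of [i] and [j] give i - j <= n + 1, so only the excluded value n + 1 is left. *)
  have : n%:Z < i - j by rewrite -(ltr_pM2l c_gt0) -xE.
  have : i - j != n.+1%:Z by apply: contra x_neq => /eqP <-; rewrite -xE.
  by lia.
have D_mem y : y \in D -> y \in ssums h.+1 (x :: multiples c n).
  case/DP => j -> j_bnd; rewrite ssums_consS; apply/or3P/Or32.
  have [|int_t _] := @mem_ssums_multiples c n h; first by lia.
  rewrite addrAC subrr add0r (_ : j = (`|j|%N)%:Z); last by lia.
  by apply: int_t; lia.
have I_mem y : y \in I -> y \in ssums h.+1 (x :: multiples c n).
  by case/IP => j -> j_bnd; rewrite ssums_consS ssums_multiples_itv.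
have IU : uniq I by rewrite map_inj_uniq ?iota_uniq // => i j; nia.
have DU : uniq D by rewrite map_inj_uniq ?iota_uniq // => i j; nia.
apply: leq_trans (_ : size (I ++ D ++ map -%R D) <= _)%N.
  by rewrite !size_cat !size_map !size_iota; lia.
apply: size_le_nssums => [|y].
  rewrite !cat_uniq IU DU (map_inj_uniq oppr_inj) DU andbT !andTb.
  apply/andP; split; apply/hasPn => y.
    rewrite mem_cat => /orP[/DI //|/mapP[z /DI zI ->]].
    apply: contra zI => /IP[j zE j_bnd]; apply/mapP.
    exists `|topsum h.+1 n - j|%N; first by rewrite mem_iota; lia.
    by rewrite -[z]opprK zE; lia.
  by case/mapP => z /D_gt0 z_gt0 ->; apply/negP => /D_gt0; lia.
rewrite 2!mem_cat => /or3P[/I_mem //|/D_mem //|/mapP[z /D_mem zD ->]].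
by rewrite ssums_opp.
Qed.

Lemma mem_multiples c n y :
  reflect (exists2 i : nat, (0 < i <= n)%N & y = c * i%:Z)
          (y \in multiples c n).
Proof.
apply: (iffP idP) => [|[i i_bnd ->]].
  elim: n => //= n IHn; rewrite inE => /predU1P[->|/IHn[i i_bnd ->]].
    by exists n.+1 => //; rewrite /= leqnn.
  by exists i => //; lia.
elim: n i_bnd => [|n IHn] i_bnd; first by lia.
have [->|i_neq] := eqVneq i n.+1; first exact: mem_head.
by rewrite inE IHn ?orbT //; lia.
Qed.

(** The companion of [last_multiple_lt] for n + 1 signs. The sign -1 on [x] makes all ci in a long
    interval offsets; more than 2 (n + 1) offsets below 2x contradict the bound. *)
Lemma last_multiple_eq c n x :
    0 < c -> (2 < n)%N -> sorted >%R (x :: multiples c n) ->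
    all (> 0) (x :: multiples c n) ->
    (nssums n.+1 (x :: multiples c n) <= n.+1 * n.+2 + 1)%N ->
  x = c * n.+1%:Z.
Proof.
move=> c_gt0 n_gt2 s_sorted s_gt0 small; apply/eqP.
apply: contraTT small => x_neq.
set s := x :: multiples c n in s_sorted s_gt0 *.
have sU : uniq s by rewrite (sorted_uniq (rev_trans lt_trans) ltxx).
have x_gt : c * n%:Z < x.
  apply: (allP (order_path_min (rev_trans lt_trans) s_sorted)).
  by apply/mem_multiples; exists n; rewrite // leqnn; lia.
have top_n := topsum_mul2 (leqnn n).
have offset_mul i : (i <= 2 * topsum n n)%N -> offset s (c * i%:Z).
  move=> i_le; rewrite /offset big_cons sum_multiples /= size_multiples.
  rewrite -[_ ++ _]/(ssums n.+1 s) ssums_consS; apply/or3P/Or33.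
  rewrite (_ : _ + x = c * (i%:Z - (topsum n n)%:Z)); last by ring.
  by apply: ssums_multiples_itv; lia.
pose N0 m := [seq c * i%:Z | i <- iota 0 m].
have N0U m : uniq (N0 m) by rewrite map_inj_uniq ?iota_uniq // => i j; nia.
suff [N [NU NP Ngt]] : exists N, [/\ uniq N,
    {in N, forall o, o < 2 * x /\ offset s o} & (2 * n.+1 < size N)%N].
  have := nssums_cons_offsets s_sorted s_gt0 NU NP; rewrite size_multiples.
  suff : (2 * topsum n n + 1 <= nssums n (multiples c n))%N.
    rewrite -ltnNge -/s; move: top_n Ngt; clear.
    by move: (nssums _ _) (nssums _ _) (topsum _ _) (size N); lia.
  pose I := [seq c * (i%:Z - (topsum n n)%:Z) |
    i <- iota 0 (2 * topsum n n).+1].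
  apply: leq_trans (_ : size I <= _)%N.
    by rewrite size_map size_iota addn1.
  apply: size_le_nssums => [|y /mapP[i]].
    by rewrite map_inj_uniq ?iota_uniq // => i j; nia.
  by rewrite mem_iota => i_lt ->; apply: ssums_multiples_itv; lia.
(* For x < c (n + 1), the ci with i <= 2n are joined by x and x + 2c, which are not multiples of
   [c]. For x > c (n + 1), all ci with i <= 2n + 2 are below 2x. *)
have [x_lt|x_ge|xE] := ltgtP x (c * n.+1%:Z); last by rewrite xE eqxx in x_neq.
  have cs : c \in multiples c n.
    by apply/mem_multiples; exists 1%N; rewrite ?mulr1 //; lia.
  have x_off : offset s x.
    have := @offset_drop_double s [::] x sU; rewrite big_nil mulr0 addr0.
    by apply=> //; rewrite mem_head.
  have xc_off : offset s (x + 2 * c).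
    have := @offset_drop_double s [:: c] x sU isT; rewrite big_seq1; apply.
    - by move=> y; rewrite inE => /eqP ->; rewrite inE cs orbT.
    - exact: mem_head.
    - by rewrite inE; apply/eqP; nia.
  have x_neq_mul j : x != c * j.
    by apply/eqP => xE; move: x_gt x_lt; rewrite xE !ltr_pM2l //; lia.
  exists (x :: x + 2 * c :: N0 (2 * n).+1); split.
  - rewrite 2!cons_uniq N0U andbT inE negb_or -andbA; apply/and3P; split.
    + by lia.
    + by apply/mapP => -[i _ xE]; case/eqP: (x_neq_mul i%:Z).
    + apply/mapP => -[i _ xE]; case/eqP: (x_neq_mul (i%:Z - 2)).
      by rewrite mulrBr -xE; ring.
  - move=> y; rewrite 2!inE => /or3P[/eqP ->|/eqP ->|/mapP[i]].
    + by split=> //; nia.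
    + by split=> //; nia.
    + rewrite mem_iota => i_lt ->; split; first by nia.
      by apply: offset_mul; nia.
  - by rewrite /= size_map size_iota; lia.
exists (N0 (2 * n + 3)%N); split=> [//|y /mapP[i]|]; last first.
  by rewrite size_map size_iota; lia.
rewrite mem_iota => i_lt ->; split; first by nia.
by apply: offset_mul; nia.
Qed.

(** 29 is the extremal value for m = 5 and h = 4; a single chain of 15 positive sums serves every x
    > 6c. *)
Lemma nssums_exception4 (c x : int) :
    0 < c -> 6 * c < x ->
  (29 < nssums 4 [:: x; 6 * c; 4 * c; 2 * c; c]%R)%N.
Proof.
move=> c_gt0 x_gt; rewrite ltnNge; apply/negP => small.
by_chain [:: [:: 1; 1; 1; 1; 0]; [:: 1; 1; 1; 0; 1]; [:: 1; 1; 1; 0; 0];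
  [:: 1; 1; 1; 0; -1]; [:: 1; 1; 1; -1; 0]; [:: 1; 1; 0; 1; -1];
  [:: 0; 1; 1; 1; 1]; [:: 0; 1; 1; 1; 0]; [:: 0; 1; 1; 0; 1];
  [:: 0; 1; 0; 1; 1]; [:: 0; 1; 1; -1; 0]; [:: 0; 1; 1; -1; -1];
  [:: 0; 1; 0; -1; 1]; [:: 0; 1; -1; 1; 0]; [:: 0; 1; -1; 0; 1]].
Qed.

Lemma nssums_exception5 (c x : int) :
    0 < c -> 6 * c < x ->
  (31 < nssums 5 [:: x; 6 * c; 4 * c; 2 * c; c]%R)%N.
Proof.
move=> c_gt0 x_gt; rewrite ltnNge; apply/negP => small.
by_chain [:: [:: 1; 1; 1; 1; 1]; [:: 1; 1; 1; 1; 0]; [:: 1; 1; 1; 1; -1];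
  [:: 1; 1; 1; -1; 1]; [:: 1; 1; 1; -1; 0]; [:: 1; 1; 1; -1; -1];
  [:: 1; 1; -1; 1; 1]; [:: 1; 1; -1; 1; 0]; [:: 1; 1; -1; 1; -1];
  [:: 1; 1; -1; -1; 1]; [:: 1; 1; -1; -1; 0]; [:: 1; 1; -1; -1; -1];
  [:: 1; -1; 1; -1; 1]; [:: 1; -1; 1; -1; 0]; [:: 1; -1; 1; -1; -1];
  [:: 0; 1; -1; -1; 1]].
Qed.

(** * The induction, and the return to [A] *)

(** With m = k - 1 the bound is 2hk - h(h + 1) + 1. It is stated as an inequality because this is
    what passes to the tail. *)
Lemma inverse_ssums h (s : seq int) :
    sorted >%R s -> all (> 0) s -> (2 < h <= size s)%N -> (3 < size s)%N ->
    (nssums h s <= h * (2 * size s + 1 - h) + 1)%N ->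
  (exists c, s = multiples c (size s)) \/
  (h = 4%N /\ exists c, s = [:: 6 * c; 4 * c; 2 * c; c]).
Proof.
elim: s h => // x s IHs h xs_sorted xs_gt0 hs s_gt3 small.
have [s_gt4|s_le] := ltnP 3 (size s); last first.
  have {s_gt3 s_le} s4 : size s = 3%N by move: s_gt3 => /=; lia.
  case: s {IHs} s4 xs_sorted xs_gt0 hs small => [|c [|b [|a [|]]]] //= _.
  rewrite !andbT => /and3P[xc cb ba] /and4P[_ _ _ a_gt0] hs small.
  have [h3|h4] : h = 3%N \/ h = 4%N by lia.
    by left; subst h; apply: inverse_three_four.
  by subst h; case: (inverse_four_four a_gt0 ba cb xc small); [left|right].
have sizeS : size (x :: s) = (size s).+1 by [].
have s_sorted := path_sorted xs_sorted.
have /andP[x_gt0 s_gt0] := xs_gt0.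
have s_lt := allP (order_path_min (rev_trans lt_trans) xs_sorted).
have c_pos c : s = multiples c (size s) -> 0 < c.
  move=> sE; have /(allP s_gt0) // : c \in s.
  by rewrite sE; apply/mem_multiples; exists 1%N; rewrite ?mulr1 //; lia.
have c_last c : s = multiples c (size s) -> c * (size s)%:Z < x.
  move=> sE; apply: s_lt; rewrite {2}sE.
  by apply/mem_multiples; exists (size s); lia.
have [h_le|h_gt] := leqP h (size s).
  (* Removing [x] lowers the bound by 2h, the gain in [nssums_cons_lt]. *)
  have small' : (nssums h s <= h * (2 * size s + 1 - h) + 1)%N.
    have := nssums_cons_lt xs_sorted xs_gt0 h_le.
    by move: small => /=; nia.
  case: (IHs h s_sorted s_gt0 _ s_gt4 small') => [|[c sE]|[h4 [c sE]]].
  - by lia.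
  - left; exists c; rewrite /= {1}sE; congr (_ :: _).
    apply: (@last_multiple_lt _ _ h); [exact: c_pos|by lia|exact: c_last|].
    rewrite -sE topsum_mul2; last by rewrite leqW.
    by move: small => /=.
  - have c_gt0 : 0 < c by apply: (allP s_gt0); rewrite sE !inE eqxx !orbT.
    have x_gt : 6 * c < x by apply: s_lt; rewrite sE mem_head.
    by have := nssums_exception4 c_gt0 x_gt; move: small; rewrite h4 sE /=; lia.
have {h_gt hs} hE : h = (size s).+1 by move: hs => /=; lia.
(* Now [h] drops with the size, and the bound by 2 (size s + 1), matched by the offsets found. *)
have small' : (nssums (size s) s <= size s * (2 * size s + 1 - size s) + 1)%N.
  have [|N [NU NP N_ge]] := many_offsets xs_sorted xs_gt0; first by lia.
  have := nssums_cons_offsets xs_sorted xs_gt0 NU NP.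
  move: small N_ge; rewrite hE sizeS; clear.
  by move: (size s) (size N) (nssums _ _) (nssums _ _) => *; nia.
case: (IHs (size s) s_sorted s_gt0 _ s_gt4 small') => [|[c sE]|[s4 [c sE]]].
- by rewrite leqnn; lia.
- left; exists c; rewrite /= {1}sE; congr (_ :: _).
  have := @last_multiple_eq c (size s) x (c_pos c sE); rewrite -sE; apply=> //.
  move: small; rewrite hE sizeS; clear.
  by move: (size s) (nssums _ _) => *; nia.
- have c_gt0 : 0 < c by apply: (allP s_gt0); rewrite sE !inE eqxx !orbT.
  have x_gt : 6 * c < x by apply: s_lt; rewrite sE mem_head.
  by have := nssums_exception5 c_gt0 x_gt; move: small; rewrite hE sE /=; lia.
Qed.

Lemma last_multiples c n : last 0 (multiples c n.+1) = c.
Proof. by elim: n => [|n IHn]; [rewrite /= mulr1|exact: IHn]. Qed.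

Lemma dilate_multiples (c : int) n (A : {fset int}) :
  A =i 0 :: multiples c n -> A = dilate c (int_itv 0 n%:Z).
Proof.
move=> AE; apply/fsetP => y; rewrite AE inE; apply/idP/imfsetP => /=.
  case/predU1P => [->|/mem_multiples[i /andP[_ i_le] ->]].
    by exists 0; rewrite ?mulr0 // in_int_itv lexx.
  by exists i%:Z => //; rewrite in_int_itv lez_nat.
case=> t; rewrite in_int_itv => /andP[t_ge0 t_le] ->.
have [-> |t_neq0] := eqVneq t 0; first by rewrite mulr0 eqxx.
apply/orP; right; apply/mem_multiples; exists `|t|%N; first by lia.
by rewrite gez0_abs.
Qed.

Theorem theorem1p2 (h k : nat) (A : {fset int}) (a : nat -> int)
  (h_ge3 : (3 <= h)%N) (h_le : (h <= k - 1)%N) (k_ge5 : (5 <= k)%N)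
  (A_enum : A = [fset a i | i in iota 1 k])
  (A_nonneg : forall x, x \in A -> 0 <= x)
  (a1_eq0 : a 1%N = 0)
  (a_incr : forall i j : nat, (1 <= i)%N -> (i < j)%N -> (j <= k)%N -> a i < a j)
  (card_eq : #|` signed_sumset h A|%:Z
             = 2 * h%:Z * k%:Z - h%:Z * (h%:Z + 1) + 1) :
  (h = 4%N /\ k = 5%N ->
     A = dilate (a 2%N) (int_itv 0 4)
     \/ A = dilate (a 2%N) [fset (0 : int); 1; 2; 4; 6])
  /\ (~ (h = 4%N /\ k = 5%N) ->
        A = dilate (a 2%N) (int_itv 0 (k%:Z - 1))).
Proof.
(* The nonzero elements in decreasing order: the largest is the head, and [a 2] comes last. *)
pose s := rev [seq a i | i <- iota 2 (k - 1)].
have size_s : size s = (k - 1)%N by rewrite size_rev size_map size_iota.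
have AE : A =i 0 :: s.
  move=> y; rewrite A_enum inE mem_rev -in_cons -a1_eq0.
  rewrite (_ : iota 1 k = 1%N :: iota 2 (k - 1)); last first.
    by case: (k) k_ge5 => // n; rewrite subn1.
  rewrite -[a 1%N :: _]/[seq a i | i <- 1%N :: iota 2 (k - 1)].
  by apply/imfsetP/mapP => -[i i_in ->]; exists i.
have a_gt0 i : (1 < i <= k)%N -> 0 < a i.
  by rewrite -a1_eq0 => ?; apply: a_incr; lia.
have s_gt0 : all (> 0) s.
  apply/allP => y; rewrite mem_rev => /mapP[i]; rewrite mem_iota => i_bnd ->.
  by apply: a_gt0; lia.
have s_sorted : sorted >%R s.
  rewrite rev_sorted sorted_map; apply/(sortedP 0%N) => i.
  rewrite size_iota => i_lt; rewrite /= !nth_iota; try lia.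
  by apply: a_incr; lia.
have s_last : last 0 s = a 2%N.
  rewrite /s; case: (k) k_ge5 => [//|[//|n]] _.
  by rewrite subn1 /= rev_cons last_rcons.
have small : (nssums h s <= h * (2 * size s + 1 - h) + 1)%N.
  apply: leq_trans (nssums_le_signed_sumset _ _ _ AE) _; first by lia.
  - by rewrite (sorted_uniq (rev_trans lt_trans) ltxx).
  - by apply/negP => /(allP s_gt0); rewrite /= ltxx.
  - by rewrite -lez_nat card_eq size_s; nia.
have hs : (2 < h <= size s)%N by rewrite size_s h_ge3.
have s_gt3 : (3 < size s)%N by rewrite size_s; lia.
case: (inverse_ssums s_sorted s_gt0 hs s_gt3 small) => [[c sE]|[h4 [c sE]]].
  have A_mul : A = dilate (a 2%N) (int_itv 0 (k%:Z - 1)).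
    (* Both are the last entry of [s]. *)
    have cE : c = a 2%N.
      rewrite -s_last sE; case: (size s) s_gt3 => // n _.
      by rewrite last_multiples.
    rewrite (_ : k%:Z - 1 = (k - 1)%N%:Z); last by lia.
    by apply: dilate_multiples; rewrite -cE -size_s -sE.
  split=> // -[_ k5]; left; rewrite A_mul k5.
  by congr (dilate _ (int_itv _ _)).
have s4 : size s = 4%N by rewrite sE.
split=> [_|]; last by case; split=> //; lia.
right; have -> : a 2%N = c by rewrite -s_last sE.
apply/fsetP => y; rewrite AE sE; apply/idP/imfsetP => /=.
  rewrite !inE => /or4P[/eqP ->|/eqP ->|/eqP ->|/orP[] /eqP ->].
  - by exists 0; rewrite ?mulr0 // !inE.
  - by exists 6; rewrite ?(mulrC c) // !inE.
  - by exists 4; rewrite ?(mulrC c) // !inE.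
  - by exists 2; rewrite ?(mulrC c) // !inE.
  - by exists 1; rewrite ?mulr1 // !inE.
case=> t; rewrite !inE -!orbA => t_in ->.
by case/or4P: t_in => [/eqP ->|/eqP ->|/eqP ->|/orP[] /eqP ->];
  rewrite ?mulr0 ?mulr1 ?(mulrC c) eqxx ?orbT.
Qed.
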